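(* Let $f_0,f_1\in\mathcal{F}$ be two power spectral densities. The length $\ell(f_\tau:0,1)$ of the logarithmic path $f_\tau(\theta)=f_0(\theta)\left(\frac{f_1(\theta)}{f_0(\theta)}\right)^\tau$, $\tau\in[0,1]$, connecting $f_0$ and $f_1$ is $$\ell_{\rm logpath}=\sqrt{\frac{1}{2\pi}\int_{-\pi}^{\pi}\left(\log\frac{f_1(\theta)}{f_0(\theta)}\right)^2d\theta-\left(\frac{1}{2\pi}\int_{-\pi}^{\pi}\log\frac{f_1(\theta)}{f_0(\theta)}\,d\theta\right)^2}.$$
   Context: $\mathcal{F}$ is the set of functions $f$ that are differentiable on $[-\pi,\pi]$, with $f(\theta)>0$ for all $\theta$, and with both $f$ and $df/d\theta$ square integrable. For a path $f_\tau$, $\tau\in[0,1]$, of spectral density functions, with $\dot f_\tau(\theta):=\partial f_\tau(\theta)/\partial\tau$, the length is $$\ell(f_\tau:0,1):=\int_0^1\sqrt{\frac{1}{2\pi}\int_{-\pi}^{\pi}\left(\frac{\dot f_\tau(\theta)}{f_\tau(\theta)}\right)^2d\theta-\left(\frac{1}{2\pi}\int_{-\pi}^{\pi}\frac{\dot f_\tau(\theta)}{f_\tau(\theta)}\,d\theta\right)^2}\;d\tau .$$ *)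

(* Defs.v *)
From HB Require Import structures.
From mathcomp Require Import all_boot all_order all_algebra.
From mathcomp Require Import all_classical all_reals all_analysis.

Set Implicit Arguments.
Unset Strict Implicit.
Unset Printing Implicit Defensive.

Import Order.TTheory GRing.Theory Num.Theory.
Import numFieldNormedType.Exports.

Local Open Scope classical_set_scope.
Local Open Scope ring_scope.

Section SpectralDensities.
Context {R : realType}.
Implicit Types (a b x : R) (f g : R -> R).

Local Notation mu := (@lebesgue_measure R).

(* The library's derivatives are two-sided. Here the increments stay inside
   `[a, b], so that the derivative at a or b is the one-sided one and values
   of f outside `[a, b] are irrelevant. *)
Definition within_quotient a b f x : set_system R :=
  (fun y => (f y - f x) / (y - x)) @ within `[a, b] x^'.

Definition differentiable_on a b f : Prop :=
  forall x, x \in `[a, b] -> cvg (within_quotient a b f x).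

Definition deriv_on a b f x : R := lim (within_quotient a b f x).

Definition square_integrable_on (D : set R) g : Prop :=
  measurable_fun D g /\ mu.-integrable D (fun x => (g x ^+ 2)%:E).

Definition spectral_class f : Prop :=
  [/\ differentiable_on (- pi) pi f,
      (forall theta : R, theta \in `[- pi, pi] -> 0 < f theta),
      square_integrable_on `[- pi, pi] f &
      square_integrable_on `[- pi, pi] (deriv_on (- pi) pi f)].

Definition circle_mean g : R :=
  (2 * pi)^-1 * \int[mu]_(theta in `[- pi, pi]) g theta.

(* A path is a function of the parameter tau first and the frequency theta
   second. *)
Definition path_dot (F : R -> R -> R) (tau theta : R) : R :=
  deriv_on 0 1 (fun t => F t theta) tau.

Definition path_length (F : R -> R -> R) : R :=
  \int[mu]_(tau in `[0, 1])
    Num.sqrt (circle_mean (fun theta => (path_dot F tau theta / F tau theta) ^+ 2)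
              - circle_mean (fun theta => path_dot F tau theta / F tau theta) ^+ 2).

Definition log_path f0 f1 (tau theta : R) : R :=
  f0 theta * (f1 theta / f0 theta) `^ tau.

End SpectralDensities.

(* Main.v *)
(** Along the logarithmic path the logarithmic derivative in [tau] is
    [ln (f1 / f0)], independently of [tau], so the speed is constant. *)
Require Import Defs.
From HB Require Import structures.
From mathcomp Require Import all_boot all_order all_algebra.
From mathcomp Require Import all_classical all_reals all_analysis.

Set Implicit Arguments.
Unset Strict Implicit.
Unset Printing Implicit Defensive.

Import Order.TTheory GRing.Theory Num.Theory.
Import numFieldNormedType.Exports.

Local Open Scope classical_set_scope.
Local Open Scope ring_scope.

(** For fixed [theta] the path is [c * r ^ tau = c * exp (tau * ln r)] with [c = f0 theta] and
    [r = f1 theta / f0 theta > 0], so dividing its [tau]-derivative by the path leaves [ln r]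
    ([path_dot_log_path]). The integrand of [path_length] is then a constant in [tau], integrated
    over an interval of length one. The analytic care goes into [path_dot], a limit of quotients
    confined to [[0, 1]]: [deriv_on_is_derive] identifies it with the usual derivative, endpoints
    included. *)

(** Properness makes the limits defining [deriv_on] unique. Since [a < b], the interval always
    leaves room on one side of [x]: the right if [x < b], the left otherwise. *)
Lemma within_itvcc_dnbhs_proper (R : realType) (a b x : R) :
  a < b -> x \in `[a, b] -> ProperFilter (within `[a, b] x^').
Proof.
move=> ab; rewrite in_itv/= => /andP[ax xb].
split; last exact: within_filter.
rewrite /within/= => H.
have Hx : nbhs x [set y | y != x -> y \in `[a, b] -> False] by exact: H.
have [xltb|blex] := ltP x b.
- suff : \forall y \near x^'+, False by move/filter_ex => [].
  near=> y.
  have xy : x < y by near: y; exact: nbhs_right_gt.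
  have : y != x -> y \in `[a, b] -> False by near: y; exact: cvg_within Hx.
  apply; first by rewrite gt_eqF.
  rewrite in_itv/= (ltW (le_lt_trans ax xy))/=.
  by near: y; exact: nbhs_right_le.
- suff : \forall y \near x^'-, False by move/filter_ex => [].
  near=> y.
  have yx : y < x by near: y; exact: nbhs_left_lt.
  have : y != x -> y \in `[a, b] -> False by near: y; exact: cvg_within Hx.
  apply; first by rewrite lt_eqF.
  rewrite in_itv/= (ltW (lt_le_trans yx xb)) andbT.
  by near: y; apply: nbhs_left_ge; exact: lt_le_trans blex.
Unshelve. all: by end_near. Qed.

Lemma deriv_on_is_derive (R : realType) (a b x : R) (f : R -> R) df :
  a < b -> x \in `[a, b] -> is_derive x 1 f df -> deriv_on a b f x = df.
Proof.
move=> ab xab fdf.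
have PF := within_itvcc_dnbhs_proper ab xab.
apply/cvg_lim => //.
(* Confining [y] to the interval only refines the filter, so the two-sided limit suffices. *)
apply: (@cvg_trans _ ((fun y => (f y - f x) / (y - x)) @ x^')).
  exact/cvg_app/cvg_within.
have [dfx dfE] := fdf.
have {dfx dfE} : h^-1 *: ((f \o shift x) (h *: 1) - f x) @[h --> 0^'] --> df.
  by rewrite -dfE; exact: dfx.
move=> /cvgrPdist_lt dfx; apply/cvgrPdist_lt => e /dfx.
(* Substituting [y = x + h] turns one difference quotient into the other. *)
rewrite !near_withinE => {}dfx; rewrite near_simpl; apply/nbhs0P.
apply: filterS dfx => h /= dfx.
rewrite -subr_eq0 (addrC x) addrK => /dfx.
by rewrite /GRing.scale/= mulr1 (mulrC h^-1).
Qed.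

Lemma is_derive_powR_exponent (R : realType) (c r t : R) : 0 < r ->
  is_derive t 1 (fun s => c * r `^ s) (c * r `^ t * ln r).
Proof.
move=> r0.
(* As [r] is nonzero, [powR] is in its exponential branch and the chain rule applies. *)
have -> : (fun s => c * r `^ s) = c \*: (expR \o (ln r \*: id)).
  by apply/funext => s; rewrite /powR gt_eqF// [s * _]mulrC.
apply: is_derive_eq.
by rewrite /powR gt_eqF// /GRing.scale/= mulr1 (mulrC t) mulrA.
Qed.

Lemma path_dot_log_path (R : realType) (f0 f1 : R -> R) (tau theta : R) :
  tau \in `[0, 1] -> 0 < f0 theta -> 0 < f1 theta ->
  path_dot (log_path f0 f1) tau theta / log_path f0 f1 tau theta =
  ln (f1 theta / f0 theta).
Proof.
move=> tau01 f0_gt0 f1_gt0.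
have r_gt0 : 0 < f1 theta / f0 theta by rewrite divr_gt0.
have dE := is_derive_powR_exponent (f0 theta) tau r_gt0.
rewrite /path_dot (deriv_on_is_derive ltr01 tau01 dE).
by rewrite mulrC mulKf// /log_path mulf_neq0 ?gt_eqF ?powR_gt0.
Qed.

Theorem proposition7 (R : realType) (f0 f1 : R -> R)
    (hf0 : spectral_class f0) (hf1 : spectral_class f1) :
  path_length (log_path f0 f1) =
  Num.sqrt (circle_mean (fun theta : R => ln (f1 theta / f0 theta) ^+ 2)
            - circle_mean (fun theta : R => ln (f1 theta / f0 theta)) ^+ 2).
Proof.
have [_ f0_gt0 _ _] := hf0; have [_ f1_gt0 _ _] := hf1.
set L := RHS.
transitivity (\int[@lebesgue_measure R]_(tau in `[0, 1]) L).
  apply: eq_Rintegral => tau; rewrite inE/= => tau01.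
  (* Positivity is known only on [[- pi, pi]], so the integrands are compared there rather than as
     functions. *)
  have logE theta : theta \in `[- pi, pi]%classic ->
      path_dot (log_path f0 f1) tau theta / log_path f0 f1 tau theta =
      ln (f1 theta / f0 theta).
    rewrite inE/= => th.
    by apply: path_dot_log_path => //; [exact: f0_gt0|exact: f1_gt0].
  congr (Num.sqrt (_ * _ - (_ * _) ^+ 2)); apply: eq_Rintegral => theta th;
    by rewrite logE.
(* The constant speed is multiplied by the measure of [[0, 1]], which is one. *)
rewrite Rintegral_cst//= lebesgue_measure_itv/= lte_fin ltr01.
by rewrite oppr0 adde0/= mulr1.
Qed.
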